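(* Let $C=(c_{ab})_{1\le a,b\le n}$ be an indecomposable symmetrizable generalized Cartan matrix with left symmetrizer $\mathrm{diag}(c_1,\dots,c_n)$, and let $\ell\ge2$ be an integer. With $H$ and $\tilde n^\varepsilon_{am,bk}\in\mathbb{Z}[z^{\pm1}]$ as defined in the context, let $N_0,N_+,N_-$ be the $H\times H$ matrices defined by $$N_\varepsilon=\bigl(z^{c_a}\tilde n^\varepsilon_{am,bk}\bigr)_{am,bk\in H}\qquad(\varepsilon\in\{0,+,-\}),$$ and write their entries as $(N_\varepsilon)_{gh}=\sum_{q\in\mathbb{Z}}n^\varepsilon_{gh;q}z^q$ for $g,h\in H$. Then the triple $(N_0,N_+,N_-)$ and the pair $(A_+,A_-)=(N_0-N_+,N_0-N_-)$ satisfy the following: (1) there are a permutation $\sigma$ of $H$ and positive integers $(p_g)_{g\in H}$ such that $n^0_{gh;q}=\delta_{gh}\delta_{q0}+\delta_{g\sigma(h)}\delta_{qp_g}$ for all $g,h,q$; moreover $n^+_{gh;q}\ge0$, $n^-_{gh;q}\ge0$ and $n^+_{gh;q}n^-_{gh;q}=0$ for all $g,h,q$; (2) the symplectic relation $A_+A_-^\dagger=A_-A_+^\dagger$ holds; (3) one has $n^+_{gh;q}=n^-_{gh;q}=0$ for all $g,h\in H$ and all $q$ not satisfying $0<q<p_g$ (with $p_g$ the positive integers in (1)) if and only if $$c_{ab}\mid c_{ba}\ \text{ or }\ c_{ba}\mid c_{ab}\quad\text{for any }1\le a,b\le n.\qquad( * )$$ Consequently, for any such Cartan matrix $C$ satisfying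 $( * )$ and any integer $\ell\ge2$, the triple $(A_+,A_-,I_H)$, where $I_H$ is the $H\times H$ identity matrix, is a T-datum of size $|H|$.
   Context: Data attached to $C$ and $\ell$: $\mathrm{diag}(c_1,\dots,c_n)$ has positive integer entries and $c_ac_{ab}=c_bc_{ba}$ for all $a,b$. Put $t_a=c_a^{-1}\mathrm{lcm}(c_1,\dots,c_n)$ and $t_{ab}=c_a^{-1}\mathrm{lcm}(c_a,c_b)$. Let $[k]_z=\frac{z^k-z^{-k}}{z-z^{-1}}$ and $[k]_{z_a}:=[k]_{z^{c_a}}$. Let $H=\{(a,m)\mid1\le a\le n,\ 1\le m\le t_a\ell-1\}$, and write $am$ for $(a,m)$. Write $a\sim b$ if $c_{ab}<0$. For $am,bk\in H$: $\tilde n^0_{am,bk}=[2]_{z_a}\delta_{ab}\delta_{mk}$; $\tilde n^+_{am,bk}=\delta_{ab}(\delta_{m,k+1}+\delta_{m,k-1})$; $\tilde n^-_{am,bk}=t_{ab}^{-1}|c_{ab}|\,[t_{ba}-|p-k|]_{z_b}$ if $a\sim b$, $p\in\mathbb{Z}$ and $|p-k|<t_{ba}$, where $p=mt_{ab}^{-1}t_{ba}$; and $\tilde n^-_{am,bk}=0$ otherwise. For a square matrix $A$ with entries in $\mathbb{Z}[z^{\pm1}]$, $A^\dagger:=(A|_{z=z^{-1}})^{\mathsf T}$. Conditions (for matrices indexed by a finite set $H$, in place of $[1,r]$, with entries $(N_\varepsilon)_{ab}=\sum_{p}n^\varepsilon_{ab;p}z^p$; the sum is over $p\in\mathbb{Z}$,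 as $N_-$ may a priori have negative powers of $z$ when (N3) fails): (N1) $n^0_{ab;p}=\delta_{ab}\delta_{p0}+\delta_{a\sigma(b)}\delta_{pp_a}$ for some permutation $\sigma$ of the index set and $p_a\in\mathbb{Z}_{>0}$; (N2) $n^\pm_{ab;p}\ge0$ for all $a,b,p$; (N3) $n^\pm_{ab;p}=0$ unless $0<p<p_a$; (N4) $n^+_{ab;p}n^-_{ab;p}=0$ for all $a,b,p$. A T-datum is a triple $(A_+,A_-,D)$ such that $A_\pm=N_0-N_\pm$ for matrices $N_0,N_+,N_-$ over $\mathbb{Z}[z]$ satisfying (N1)-(N4), and $D$ is a positive integer diagonal matrix with $N_0D=DN_0$, $D^{-1}N_\pm D$ having entries in $\mathbb{Z}[z]$, and $A_+DA_-^\dagger=A_-DA_+^\dagger$. Its size is the size of the matrices. *)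

(* Defs.v *)
From HB Require Import structures.
From mathcomp Require Import all_boot all_order all_algebra all_fingroup.
From mathcomp Require Import finmap ring.
From mathcomp.multinomials Require Import monalg.

Set Implicit Arguments.
Unset Strict Implicit.
Unset Printing Implicit Defensive.

Import Order.TTheory GRing.Theory Num.Theory.
Local Open Scope fset_scope.
Local Open Scope ring_scope.

(* The ring Z[z, z^-1].  A Laurent polynomial is a finitely supported function
   int -> int, with g@_q the coefficient of z^q and << c *g q >> = c z^q.
   monalg provides the additive group; its product is only available for
   monoids of exponents without nontrivial units, so the convolution product
   on exponents in int is added here. *)
Definition laurent : Type := {malg int[int]}.

HB.instance Definition _ := GRing.Zmodule.copy laurent {malg int[int]}.
Bind Scope ring_scope with laurent.

Definition laurent_one : laurent := << 1 *g 0 >>.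

Definition laurent_mul (f g : laurent) : laurent :=
  \sum_(k <- msupp f) \sum_(l <- msupp g) << f@_k * g@_l *g k + l >>.

Lemma laurent_mulw (d1 d2 : {fset int}) (f g : laurent) :
  msupp f `<=` d1 -> msupp g `<=` d2 ->
  laurent_mul f g = \sum_(k <- d1) \sum_(l <- d2) << f@_k * g@_l *g k + l >>.
Proof.
move=> le1 le2; rewrite /laurent_mul (big_fset_incl _ le1) /=.
  apply/eq_bigr=> k1 _; apply/big_fset_incl => // k _ /mcoeff_outdom ->.
  by rewrite mulr0 monalgU0.
move=> k _ /mcoeff_outdom fk.
by rewrite big1 // => l _; rewrite fk mul0r monalgU0.
Qed.

Lemma laurent_mulC : commutative laurent_mul.
Proof.
move=> f g; rewrite /laurent_mul exchange_big.
by apply/eq_bigr=> k _; apply/eq_bigr=> l _; rewrite mulrC addrC.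
Qed.

Lemma laurent_mulU (c : int) (k : int) (g : laurent) :
  laurent_mul << c *g k >> g = \sum_(l <- msupp g) << c * g@_l *g k + l >>.
Proof.
rewrite (laurent_mulw msuppU_le (fsubset_refl _)) big_seq_fset1.
by apply/eq_bigr => l _; rewrite mcoeffUU.
Qed.

Lemma laurent_mulUU (c d k l : int) :
  laurent_mul << c *g k >> << d *g l >> = << c * d *g k + l >>.
Proof. by rewrite (laurent_mulw msuppU_le msuppU_le) !big_seq_fset1 !mcoeffUU. Qed.

Lemma laurent_mul1 : left_id laurent_one laurent_mul.
Proof.
move=> g; rewrite laurent_mulU [RHS]monalgE.
by apply/eq_bigr=> k _; rewrite mul1r add0r.
Qed.

Lemma laurent_mulDl : left_distributive laurent_mul +%R.
Proof.
move=> f1 f2 g.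
rewrite (laurent_mulw (fsubsetUl (msupp f1) (msupp f2)) (fsubset_refl (msupp g))).
rewrite (laurent_mulw (fsubsetUr (msupp f1) (msupp f2)) (fsubset_refl (msupp g))).
have le12 : msupp (f1 + f2 : laurent) `<=` msupp f1 `|` msupp f2.
  exact: msuppD_le.
rewrite (laurent_mulw le12 (fsubset_refl (msupp g))).
rewrite -big_split /=; apply/eq_bigr=> k _.
rewrite -big_split /=; apply/eq_bigr=> l _.
by rewrite mcoeffD mulrDl monalgUD.
Qed.

Lemma laurent_mulDr : right_distributive laurent_mul +%R.
Proof. by move=> f g h; rewrite !(laurent_mulC f) laurent_mulDl. Qed.

Lemma laurent_mul0 : left_zero 0 laurent_mul.
Proof. by move=> g; rewrite /laurent_mul msupp0 big_seq_fset0. Qed.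

Lemma laurentE (f : laurent) :
  f = \sum_(k <- msupp f) (<< f@_k *g k >> : laurent).
Proof. exact: monalgE. Qed.

Lemma laurent_mulA : associative laurent_mul.
Proof.
have sumL (s : seq int) (F : int -> laurent) h :
    laurent_mul (\sum_(k <- s) F k) h = \sum_(k <- s) laurent_mul (F k) h.
  apply: (big_morph (laurent_mul^~ h)) => [? ?|]; first exact: laurent_mulDl.
  exact: laurent_mul0.
have sumR (s : seq int) (F : int -> laurent) h :
    laurent_mul h (\sum_(k <- s) F k) = \sum_(k <- s) laurent_mul h (F k).
  by rewrite laurent_mulC sumL; apply/eq_bigr=> k _; rewrite laurent_mulC.
have mulUU := laurent_mulUU.
move: sumL sumR mulUU; move: laurent_mul => mul sumL sumR mulUU f g h.
rewrite [f]laurentE [g]laurentE [h]laurentE.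
rewrite !sumL; apply: eq_bigr=> k _.
rewrite sumR (sumR (msupp g)) sumL; apply: eq_bigr=> l _.
rewrite !sumR; apply: eq_bigr=> m _.
by rewrite !mulUU mulrA addrA.
Qed.

Lemma laurent_one_neq0 : laurent_one != 0.
Proof.
by apply/eqP => /malgP/(_ 0); rewrite mcoeffUU mcoeff0 => /eqP; rewrite oner_eq0.
Qed.

HB.instance Definition _ := GRing.Zmodule_isComNzRing.Build laurent
  laurent_mulA laurent_mulC laurent_mul1 laurent_mulDl laurent_one_neq0.

Definition zpow (q : int) : laurent := << 1 *g q >>.

Lemma zpow0 : zpow 0 = 1. Proof. by []. Qed.

Lemma zpowD p q : zpow (p + q) = zpow p * zpow q.
Proof. by rewrite [RHS]laurent_mulUU mulr1. Qed.

(* f |-> f|_{z = z^-1} *)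
Definition laurent_inv (f : laurent) : laurent :=
  \sum_(q <- msupp f) << f@_q *g - q >>.

Lemma coef_laurent_inv (f : laurent) (q : int) : (laurent_inv f)@_q = f@_(- q).
Proof.
rewrite /laurent_inv raddf_sum /=.
under eq_bigr => k _ do rewrite mcoeffU eqr_oppLR.
case: (boolP (- q \in msupp f)) => [qf|qf].
  rewrite (big_fsetD1 _ qf) /= eqxx mulr1n big1_seq ?addr0 // => k /=.
  rewrite !inE eq_sym => /andP[/negPf + _].
  by rewrite eq_sym => ->; rewrite mulr0n.
rewrite (mcoeff_outdom qf) big1_seq // => k /= kf.
by case: eqP => [E|_]; rewrite ?mulr0n //; rewrite -E kf in qf.
Qed.

(* [k]_{z^c} = (z^(ck) - z^(-ck)) / (z^c - z^(-c)), as a Laurent polynomial;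
   see qnumE. *)
Definition qnum (c k : nat) : laurent :=
  \sum_(i < k) zpow (c%:Z * (k%:Z - 1 - 2 * i%:Z)).

Lemma qnumE (c k : nat) :
  qnum c k * (zpow c%:Z - zpow (- c%:Z)) =
  zpow (c%:Z * k%:Z) - zpow (- (c%:Z * k%:Z)).
Proof.
pose u (i : nat) := - zpow (c%:Z * (k%:Z - 2 * i%:Z)).
rewrite /qnum big_distrl /= (eq_bigr (fun i : 'I_k => u i.+1 - u i)); last first.
  move=> i _; rewrite mulrBr -!zpowD /u opprK addrC.
  by congr (- zpow _ + zpow _); rewrite ?intS; ring.
rewrite -(big_mkord xpredT (fun i => u i.+1 - u i)) telescope_sumr //.
by rewrite /u mulr0 subr0 opprK addrC; congr (_ - zpow _); ring.
Qed.

Definition dagger (r : nat) (A : 'M[laurent]_r) : 'M[laurent]_r :=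
  (map_mx laurent_inv A)^T.

(* All entries lie in the subring Z[z]. *)
Definition over_Zz (r : nat) (A : 'M[laurent]_r) : Prop :=
  forall i j (q : int), q < 0 -> (A i j)@_q = 0.

Definition condN1 (r : nat) (N0 : 'M[laurent]_r)
    (sigma : 'S_r) (p : 'I_r -> nat) : Prop :=
  (forall i, (0 < p i)%N) /\
  (forall i j (q : int),
     (N0 i j)@_q = (i == j)%:R * (q == 0)%:R
                   + (i == sigma j)%:R * (q == (p i)%:Z)%:R).

Definition condN2 (r : nat) (Np Nm : 'M[laurent]_r) : Prop :=
  forall i j (q : int), 0 <= (Np i j)@_q /\ 0 <= (Nm i j)@_q.

Definition condN3 (r : nat) (Np Nm : 'M[laurent]_r) (p : 'I_r -> nat) : Prop :=
  forall i j (q : int), ~~ (0 < q < (p i)%:Z) ->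
    (Np i j)@_q = 0 /\ (Nm i j)@_q = 0.

Definition condN4 (r : nat) (Np Nm : 'M[laurent]_r) : Prop :=
  forall i j (q : int), (Np i j)@_q * (Nm i j)@_q = 0.

(* D^-1 N D has entries in Z[z]: D^-1 N D = M is written N D = D M, which is
   the same because D is diagonal with nonzero integer entries. *)
Definition conj_over_Zz (r : nat) (D N : 'M[laurent]_r) : Prop :=
  exists2 M, over_Zz M & N *m D = D *m M.

Definition is_Tdatum (r : nat) (Ap Am : 'M[laurent]_r) (D : 'M[int]_r) : Prop :=
  let DL : 'M[laurent]_r := map_mx intr D in
  [/\ is_diag_mx D, (forall i, 0 < D i i),
      (exists N0 Np Nm : 'M[laurent]_r,
        [/\ [/\ over_Zz N0, over_Zz Np & over_Zz Nm],
            Ap = N0 - Np /\ Am = N0 - Nm,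
            (exists (sigma : 'S_r) (p : 'I_r -> nat),
              [/\ condN1 N0 sigma p, condN2 Np Nm, condN3 Np Nm p
                & condN4 Np Nm]),
            N0 *m DL = DL *m N0
          & conj_over_Zz DL Np /\ conj_over_Zz DL Nm])
    & Ap *m DL *m dagger Am = Am *m DL *m dagger Ap].

Definition gen_cartan (n : nat) (C : 'M[int]_n) : Prop :=
  [/\ forall a, C a a = 2,
      forall a b, a != b -> C a b <= 0
    & forall a b, C a b = 0 <-> C b a = 0].

Definition left_symmetrizer (n : nat) (c : 'I_n -> nat) (C : 'M[int]_n) : Prop :=
  (forall a, (0 < c a)%N) /\
  (forall a b, (c a)%:Z * C a b = (c b)%:Z * C b a).

Definition indecomposable (n : nat) (C : 'M[int]_n) : Prop :=
  (0 < n)%N /\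
  ~ (exists S : {set 'I_n},
       [/\ S != set0, S != setT
         & forall a b, a \in S -> b \notin S -> C a b = 0 /\ C b a = 0]).

(* t_a and t_ab; both divisions are exact. *)
Definition t1 (n : nat) (c : 'I_n -> nat) (a : 'I_n) : nat :=
  ((\big[lcmn/1%N]_(b < n) c b) %/ c a)%N.

Definition t2 (n : nat) (c : 'I_n -> nat) (a b : 'I_n) : nat :=
  (lcmn (c a) (c b) %/ c a)%N.

(* The index set H: the pair (a, m) with 1 <= m <= t_a l - 1 is encoded by a
   and the ordinal m - 1 < t_a l - 1. *)
Definition Hidx (n : nat) (c : 'I_n -> nat) (l : nat) : finType :=
  {a : 'I_n & 'I_(t1 c a * l - 1)}.

Definition Hm (n : nat) (c : 'I_n -> nat) (l : nat) (h : Hidx c l) : nat :=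
  (tagged h).+1.

Definition ntilde0 (n : nat) (c : 'I_n -> nat) (a : 'I_n) (m : nat)
    (b : 'I_n) (k : nat) : laurent :=
  qnum (c a) 2 * (a == b)%:R * (m == k)%:R.

Definition ntildep (n : nat) (a : 'I_n) (m : nat) (b : 'I_n) (k : nat) :
    laurent :=
  (a == b)%:R * ((m == k.+1)%:R + (m.+1 == k)%:R).

(* t_ab divides |c_ab| by symmetrizability, so that quotient is exact; the
   test t_ab %| m t_ba says that p = m t_ba / t_ab is an integer. *)
Definition ntildem (n : nat) (C : 'M[int]_n) (c : 'I_n -> nat)
    (a : 'I_n) (m : nat) (b : 'I_n) (k : nat) : laurent :=
  let p := (m * t2 c b a %/ t2 c a b)%N in
  let d := absz (p%:Z - k%:Z) in
  if [&& C a b < 0, (t2 c a b %| m * t2 c b a)%N & (d < t2 c b a)%N]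
  then (absz (C a b) %/ t2 c a b)%N%:R * qnum (c b) (t2 c b a - d)
  else 0.

Lemma t2_dvd_cartan (n : nat) (C : 'M[int]_n) (c : 'I_n -> nat) (a b : 'I_n) :
  left_symmetrizer c C -> (t2 c a b %| absz (C a b))%N.
Proof.
case=> cpos /(_ a b) /(congr1 absz); rewrite !abszM /= => E.
have g0 : (0 < gcdn (c a) (c b))%N by rewrite gcdn_gt0 cpos.
have -> : t2 c a b = (c b %/ gcdn (c a) (c b))%N.
  by rewrite /t2 /lcmn -muln_divA ?dvdn_gcdr // mulKn.
rewrite -(@Gauss_dvdr _ (c a %/ gcdn (c a) (c b))%N); last first.
  rewrite /coprime -(eqn_pmul2r g0) muln_gcdl !divnK ?dvdn_gcdl ?dvdn_gcdr //.
  by rewrite gcdnC mul1n.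
rewrite -(dvdn_pmul2r g0) divnK ?dvdn_gcdr // mulnAC divnK ?dvdn_gcdl //.
by rewrite E dvdn_mulr.
Qed.

(* The H x H matrix (z^(c_a) f_{am,bk}); H is identified with 'I_#|H| by
   enum_val. *)
Definition Hmx (n : nat) (c : 'I_n -> nat) (l : nat)
    (f : 'I_n -> nat -> 'I_n -> nat -> laurent) : 'M[laurent]_#|Hidx c l| :=
  \matrix_(i, j)
    let g : Hidx c l := enum_val i in let h : Hidx c l := enum_val j in
    zpow (c (tag g))%:Z * f (tag g) (Hm g) (tag h) (Hm h).

Definition dvd_cond (n : nat) (C : 'M[int]_n) : Prop :=
  forall a b, (C a b %| C b a)%Z \/ (C b a %| C a b)%Z.

(* Main.v *)
Require Import Defs.
From mathcomp Require Import all_boot all_order all_algebra all_fingroup.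
From mathcomp Require Import ring zify.
From mathcomp.multinomials Require Import monalg.

Import Order.TTheory GRing.Theory Num.Theory.
Local Open Scope ring_scope.

(* Write N_e = Z T_e with Z = diag(z^(c_a)). The entries of T_e are invariant
   under z |-> z^-1, so A_+ A_-^dagger = Z (T_0 - T_+) (T_0 - T_-)^T Z^-1 and
   the symplectic relation says that T_- (T_0 - T_+) is a symmetric matrix.
   Right multiplication by T_0 - T_+ is the second difference
   f(k) |-> [2]_(z_b) f(k) - f(k-1) - f(k+1), which kills [t - |p - k|]_(z_b)
   away from k = p and |k - p| = t. With L = lcm(c_a, c_b), u = t_ab, w = t_ba,
   what remains is t_ab^-1 |c_ab| times
   (z^L + z^-L) [m w = k u] - [|m w - k u| = u w], visibly symmetric under
   (a, m, u) <-> (b, k, w).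
   The entry of N_- at m = u, k = w has lowest exponent c_a + c_b - L, so
   condition (N3) says L < c_a + c_b, that is c_a | c_b or c_b | c_a. *)

(** * Coefficients of quantum integers and the substitution z |-> z^-1 *)

Lemma coef_zpow (p q : int) : (zpow p)@_q = (p == q)%:R.
Proof. by rewrite mcoeffU. Qed.

Lemma coef_zpow_mul (p : int) (f : laurent) (q : int) :
  (zpow p * f)@_q = f@_(q - p).
Proof.
rewrite [f]laurentE mulr_sumr !raddf_sum /=; apply: eq_bigr => k _.
by rewrite [zpow p * _]laurent_mulUU mul1r !mcoeffU eq_sym addrC -subr_eq eq_sym.
Qed.

Lemma coef_natr_mul (k : nat) (f : laurent) (q : int) :
  (k%:R * f)@_q = f@_q *+ k.
Proof. by rewrite mulr_natl raddfMn. Qed.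

Lemma coef_qnum (c k : nat) (q : int) :
  (qnum c k)@_q = \sum_(i < k) (c%:Z * (k%:Z - 1 - 2 * i%:Z) == q)%:R.
Proof. by rewrite raddf_sum; apply: eq_bigr => i _; exact: coef_zpow. Qed.

Lemma coef_qnum_ge0 (c k : nat) (q : int) : 0 <= (qnum c k)@_q.
Proof. by rewrite coef_qnum sumr_ge0. Qed.

(** The exponents that occur have absolute value at most c(k - 1). *)
Lemma coef_qnum_out (c k : nat) (q : int) :
  c%:Z * k%:Z < `|q| + c%:Z -> (qnum c k)@_q = 0.
Proof.
move=> lt; rewrite coef_qnum big1 // => i _; case: eqP => // E.
by have := ltn_ord i; move: lt; rewrite -E; nia.
Qed.

(** Only the last summand reaches the bottom exponent, the one that violates (N3) when neither of
    c_a, c_b divides the other. *)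
Lemma coef_qnum_low (c k : nat) :
  (0 < c)%N -> (0 < k)%N -> (qnum c k)@_(c%:Z - c%:Z * k%:Z) = 1.
Proof.
move=> c0; case: k => // k _; rewrite coef_qnum big_ord_recr /= big1 ?add0r.
  by case: eqP => // -[]; rewrite intS; ring.
by move=> i _; case: eqP => // E; have := ltn_ord i; nia.
Qed.

Lemma laurent_invB (f g : laurent) :
  laurent_inv (f - g) = laurent_inv f - laurent_inv g.
Proof. by apply/malgP => q; rewrite mcoeffB !coef_laurent_inv mcoeffB. Qed.

Lemma laurent_inv_zpow_mul (p : int) (f : laurent) :
  laurent_inv (zpow p * f) = zpow (- p) * laurent_inv f.
Proof.
apply/malgP => q; rewrite coef_zpow_mul !coef_laurent_inv coef_zpow_mul.
by congr (_@_ _); ring.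
Qed.

Lemma laurent_inv_natr_mul (k : nat) (f : laurent) :
  laurent_inv (k%:R * f) = k%:R * laurent_inv f.
Proof.
by apply/malgP => q; rewrite coef_natr_mul !coef_laurent_inv coef_natr_mul.
Qed.

Lemma laurent_inv_nat (k : nat) : laurent_inv k%:R = k%:R.
Proof.
apply/malgP => q; rewrite coef_laurent_inv -[k%:R]mulr1 !coef_natr_mul.
by rewrite !coef_zpow eq_sym oppr_eq0 eq_sym.
Qed.

Lemma laurent_inv_qnum (c k : nat) : laurent_inv (qnum c k) = qnum c k.
Proof.
apply/malgP => q; rewrite coef_laurent_inv !coef_qnum.
(* Reversing the summation index negates every exponent. *)
rewrite (reindex_inj rev_ord_inj); apply: eq_bigr => i _ /=.
rewrite -subzn // -[in LHS]eqr_opp opprK.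
by congr (_ == _)%:R; rewrite intS; ring.
Qed.

(** * Recurrences and the second difference of quantum integers *)

Lemma qnum0 (c : nat) : qnum c 0 = 0.
Proof. by rewrite /qnum big_ord0. Qed.

Lemma qnum1 (c : nat) : qnum c 1 = 1.
Proof. by rewrite /qnum big_ord1 -zpow0; congr zpow; rewrite /=; lia. Qed.

Lemma qnum2 (c : nat) : qnum c 2 = zpow c%:Z + zpow (- c%:Z).
Proof.
by rewrite /qnum big_ord_recr big_ord1 /=; congr (zpow _ + zpow _); lia.
Qed.

Lemma qnumS (c k : nat) :
  qnum c k.+1 = zpow c%:Z * qnum c k + zpow (- (c%:Z * k%:Z)).
Proof.
rewrite /qnum big_ord_recr /= mulr_sumr; congr (_ + zpow _).
  by apply: eq_bigr => i _; rewrite -zpowD; congr zpow; rewrite intS; ring.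
by rewrite intS; ring.
Qed.

Lemma qnumSl (c k : nat) :
  qnum c k.+1 = zpow (- c%:Z) * qnum c k + zpow (c%:Z * k%:Z).
Proof.
rewrite /qnum big_ord_recl /= addrC mulr_sumr; congr (_ + zpow _).
  apply: eq_bigr => i _; rewrite -zpowD; congr zpow.
  by rewrite /bump leq0n /= add1n !intS; ring.
by rewrite intS; ring.
Qed.

Lemma zpowK (p : int) : zpow p * zpow (- p) = 1.
Proof. by rewrite -zpowD subrr. Qed.

(** One recursion peels off the lowest term and the other the highest; their shifts cancel. *)
Lemma qnum_diff (c k : nat) :
  qnum c k.+2 - qnum c k = zpow (c%:Z * k.+1%:Z) + zpow (- (c%:Z * k.+1%:Z)).
Proof.
rewrite qnumS [qnum c k.+1]qnumSl mulrDr mulrA zpowK mul1r -zpowD.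
rewrite [c%:Z + _](_ : _ = c%:Z * k.+1%:Z); last by rewrite intS; ring.
by ring.
Qed.

Lemma qnum2_mul (c k : nat) : qnum c 2 * qnum c k.+1 = qnum c k.+2 + qnum c k.
Proof.
rewrite [qnum c k.+2]qnumS qnum2 mulrDl -addrA; congr (_ + _).
rewrite [in LHS]qnumS mulrDr mulrA [zpow (- _) * _]mulrC zpowK mul1r -zpowD.
rewrite [RHS]addrC; congr (_ + zpow _).
by rewrite intS; ring.
Qed.

(** Subtraction truncates, so F is the tent y |-> [w - |y|] extended by zero. Its slopes cancel by
    [qnum2_mul]; the apex leaves z^(cw) + z^(-cw), and at |x| = w the inner neighbour [1] = 1 is
    left over. *)
Lemma qnum_second_diff (c w : nat) (x : int) : (0 < w)%N ->
  let F (y : int) := qnum c (w - absz y) in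
  qnum c 2 * F x - F (x - 1) - F (x + 1) =
  (zpow (c * w)%N%:Z + zpow (- (c * w)%N%:Z)) * (x == 0)%:R
  - (absz x == w)%:R.
Proof.
move=> w0 F.
have FN y : F (- y) = F y by rewrite /F abszN.
wlog x0 : x / 0 <= x.
  move=> H; case: (lerP 0 x) => [/H //|x0].
  have := H (- x); rewrite oppr_eq0 abszN => <-; last by lia.
  rewrite -FN -(FN (x - 1)) -(FN (x + 1)) -addrA [- _ - _]addrC addrA.
  by congr (_ - F _ - F _); ring.
case: x x0 => // -[|d] _.
  rewrite eqxx mulr1 !add0r FN /F subn0 eq_sym eqn0Ngt w0 subr0.
  case: w w0 {F FN} => // w _; rewrite subn1 /= qnum2_mul PoszM.
  by rewrite -qnum_diff; ring.
have -> : d.+1%:Z - 1 = d%:Z by rewrite intS; ring.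
have -> : d.+1%:Z + 1 = d.+2%:Z by rewrite [RHS]intS; ring.
rewrite /F !absz_nat mulr0 sub0r.
(* Slope, exterior and foot of the tent, in this order. *)
case: (ltngtP d.+1 w) => [lt|gt|E].
- have -> : (w - d = (w - d.+2).+2)%N by lia.
  have -> : (w - d.+1 = (w - d.+2).+1)%N by lia.
  by rewrite qnum2_mul mulr0n; ring.
- have [-> -> ->] : [/\ w - d = 0, w - d.+1 = 0 & w - d.+2 = 0]%N by split; lia.
  by rewrite qnum0 mulr0n; ring.
have [-> -> ->] : [/\ w - d = 1, w - d.+1 = 0 & w - d.+2 = 0]%N by split; lia.
by rewrite qnum0 qnum1 mulr1n; ring.
Qed.

(** * The index set H and sums over it *)

Lemma Hidx_eqE {n : nat} {c : 'I_n -> nat} {l : nat} (g h : Hidx c l) :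
  (g == h) = (tag g == tag h) && (Hm g == Hm h).
Proof.
apply/eqP/andP => [-> //|[]]; case: g h => a i [b j] /= /eqP E.
by case: b / E j => j; rewrite /Hm /= eqSS => /eqP/val_inj ->.
Qed.

Lemma Hm_lt {n : nat} {c : 'I_n -> nat} {l : nat} (h : Hidx c l) :
  (Hm h < t1 c (tag h) * l)%N.
Proof. by rewrite /Hm; have := ltn_ord (tagged h); lia. Qed.

Lemma Hm_surj {n : nat} {c : 'I_n -> nat} {l : nat} {b : 'I_n} {k : nat} :
  (0 < k < t1 c b * l)%N -> exists h : Hidx c l, tag h = b /\ Hm h = k.
Proof.
case: k => // k lt; have ltk : (k < t1 c b * l - 1)%N by lia.
by exists (Tagged (fun a => 'I_(t1 c a * l - 1)) (Ordinal ltk)).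
Qed.

(** Vanishing of F at 0 and t_b l, just outside H, lets the neighbours k - 1 and k + 1 of an index
    be selected even when they leave H. *)
Lemma sum_Hidx_delta (n : nat) (c : 'I_n -> nat) (l : nat)
    (F : 'I_n -> nat -> laurent) (b : 'I_n) (k : nat) :
    (k <= t1 c b * l)%N -> F b 0%N = 0 -> F b (t1 c b * l)%N = 0 ->
  \sum_(h : Hidx c l)
    F (tag h) (Hm h) * ((tag h == b)%:R * (Hm h == k)%:R) = F b k.
Proof.
move=> lek F0 Fl; case: (boolP (0 < k < t1 c b * l)%N) => [|out].
  case/Hm_surj => h0 [tb mk]; rewrite (bigD1 h0) //= tb mk !eqxx !mulr1.
  rewrite big1 ?addr0 // => h; rewrite Hidx_eqE tb mk => /negPf nh.
  by rewrite -natrM mulnb nh mulr0.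
rewrite big1 => [|h _].
  by move: out; case: (posnP k) => [-> //|/= k0]; rewrite -leqNgt => ?;
     rewrite (_ : k = (t1 c b * l)%N) ?Fl //; lia.
have := Hm_lt h; case: eqP => [->|]; case: eqP => [E|]; rewrite ?mulr0 ?mul0r ?mulr0 //.
by rewrite E => lt; case/negP: out; rewrite lt -E.
Qed.

(** * Arithmetic of t_a, t_ab and the Cartan entries *)

Lemma mul_t2 (n : nat) (c : 'I_n -> nat) (a b : 'I_n) :
  (c a * t2 c a b)%N = lcmn (c a) (c b).
Proof. by rewrite /t2 mulnC divnK // dvdn_lcml. Qed.

Lemma coprime_t2 (n : nat) (c : 'I_n -> nat) (a b : 'I_n) :
  (0 < c a)%N -> (0 < c b)%N -> coprime (t2 c a b) (t2 c b a).
Proof.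
move=> a0 b0; have g0 : (0 < gcdn (c a) (c b))%N by rewrite gcdn_gt0 a0.
have t2E a' b' : (0 < c a')%N -> t2 c a' b' = (c b' %/ gcdn (c a') (c b'))%N.
  by move=> a'0; rewrite /t2 /lcmn -muln_divA ?dvdn_gcdr // mulKn.
rewrite /coprime !t2E // [gcdn (c b) _]gcdnC -(eqn_pmul2r g0) mul1n.
by rewrite muln_gcdl !divnK ?dvdn_gcdl ?dvdn_gcdr // gcdnC.
Qed.

(** The common factor e is lcm(c_1, ..., c_n) / lcm(c_a, c_b). *)
Lemma t1_split (n : nat) (c : 'I_n -> nat) (a b : 'I_n) :
    (forall a, (0 < c a)%N) ->
  exists e, [/\ (0 < e)%N, t1 c a = (e * t2 c a b)%N & t1 c b = (e * t2 c b a)%N].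
Proof.
move=> cpos; set L := (\big[lcmn/1%N]_(i < n) c i).
have dvdL i : (c i %| L)%N by rewrite /L (bigD1 i) //= dvdn_lcml.
have L0 : (0 < L)%N.
  by rewrite /L; elim/big_rec: _ => // i x _ x0; rewrite lcmn_gt0 cpos.
have /dvdnP[e E] : (lcmn (c a) (c b) %| L)%N by rewrite dvdn_lcm !dvdL.
exists e; split; first by move: L0; rewrite E muln_gt0 => /andP[].
  by rewrite /t1 -/L E -muln_divA ?dvdn_lcml.
by rewrite /t1 -/L E lcmnC -muln_divA ?dvdn_lcml.
Qed.

(** Divide c_a |c_ab| = c_b |c_ba| by lcm(c_a, c_b) = c_a t_ab = c_b t_ba. *)
Lemma coef_cartan_sym (n : nat) (C : 'M[int]_n) (c : 'I_n -> nat) (a b : 'I_n) :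
    left_symmetrizer c C ->
  (absz (C a b) %/ t2 c a b = absz (C b a) %/ t2 c b a)%N.
Proof.
move=> hc; case: (hc) => cpos /(_ a b) /(congr1 absz); rewrite !abszM /= => E.
have [/dvdnP[x Ex] /dvdnP[y Ey]] := (t2_dvd_cartan a b hc, t2_dvd_cartan b a hc).
have L0 : (0 < lcmn (c a) (c b))%N by rewrite lcmn_gt0 !cpos.
have u0 : (0 < t2 c a b)%N by move: L0; rewrite -mul_t2 muln_gt0 => /andP[].
have w0 : (0 < t2 c b a)%N.
  by move: L0; rewrite lcmnC -mul_t2 muln_gt0 => /andP[].
rewrite Ex Ey !mulnK //; apply/eqP; rewrite -(eqn_pmul2l L0).
by rewrite -{1}mul_t2 lcmnC -mul_t2 -!mulnA ![(t2 _ _ _ * _)%N]mulnC -Ex -Ey E.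
Qed.

Lemma t2_gt0 (n : nat) (c : 'I_n -> nat) (a b : 'I_n) :
  (0 < c a)%N -> (0 < c b)%N -> (0 < t2 c a b)%N.
Proof.
move=> a0 b0; have : (0 < lcmn (c a) (c b))%N by rewrite lcmn_gt0 a0.
by rewrite -mul_t2 muln_gt0 => /andP[].
Qed.

(** * The entries of T_- and their second difference *)

(** As t_ab and t_ba are coprime, p is an integer exactly when t_ab divides m. The test |p - k| <
    t_ba disappears because truncated subtraction yields [0] = 0 beyond it. *)
Lemma ntildemE (n : nat) (C : 'M[int]_n) (c : 'I_n -> nat) (a b : 'I_n)
    (m k : nat) :
    (0 < c a)%N -> (0 < c b)%N ->
  ntildem C c a m b k =
  if (C a b < 0) && (t2 c a b %| m)%N then
    (absz (C a b) %/ t2 c a b)%N%:R *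
    qnum (c b) (t2 c b a - absz ((m %/ t2 c a b * t2 c b a)%N%:Z - k%:Z))
  else 0.
Proof.
move=> a0 b0; have u0 := t2_gt0 _ c a b a0 b0; rewrite /ntildem.
rewrite Gauss_dvdl; last exact: coprime_t2.
case: (C a b < 0) => [|//]; rewrite !andTb.
case: (boolP (t2 c a b %| m)%N) => [dv|//]; rewrite andTb -divn_mulAC //.
case: ltnP => //; rewrite -subn_eq0 => /eqP ->.
by rewrite qnum0 mulr0.
Qed.

(** If m = m' t_ab, then p = m' t_ba is a multiple of t_ba strictly between 0 and t_b l = e l t_ba,
    hence at distance at least t_ba from both ends. *)
Lemma ntildem_border (n : nat) (C : 'M[int]_n) (c : 'I_n -> nat) (l : nat)
    (a b : 'I_n) (m : nat) :
    (forall a, (0 < c a)%N) -> (0 < m < t1 c a * l)%N ->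
  ntildem C c a m b 0 = 0 /\ ntildem C c a m b (t1 c b * l) = 0.
Proof.
move=> cpos /andP[m0 ml]; rewrite !ntildemE //.
have [e [e0 Ea Eb]] := t1_split n c a b cpos.
have w0 := t2_gt0 _ c b a (cpos b) (cpos a).
case: ifP => // /andP[_ /dvdnP[m' E]]; rewrite {}E in m0 ml *.
move: m0 ml; rewrite Ea Eb muln_gt0 => /andP[m'0 u0]; rewrite mulnAC.
rewrite ltn_pmul2r // mulnK // mulnAC => lt.
suff [-> ->] : (t2 c b a - absz ((m' * t2 c b a)%N%:Z - 0%N%:Z) = 0 /\
    t2 c b a - absz ((m' * t2 c b a)%N%:Z - (e * l * t2 c b a)%N%:Z) = 0)%N.
  by rewrite qnum0 mulr0.
by split; nia.
Qed.

(** Rescaling p - k to x = t_ab (p - k) stays within the integers and turns the exchange of (a, m)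
    and (b, k) into a change of sign. *)
Lemma ntildem_second_diff (n : nat) (C : 'M[int]_n) (c : 'I_n -> nat)
    (a b : 'I_n) (m k : nat) :
    left_symmetrizer c C -> (0 < k)%N ->
  let L := (lcmn (c a) (c b))%:Z in
  let x := (m * t2 c b a)%N%:Z - (k * t2 c a b)%N%:Z in
  qnum (c b) 2 * ntildem C c a m b k - ntildem C c a m b k.-1
    - ntildem C c a m b k.+1 =
  (C a b < 0)%R%:R * (absz (C a b) %/ t2 c a b)%N%:R *
  ((zpow L + zpow (- L)) * (x == 0)%:R
   - (absz x == t2 c a b * t2 c b a)%N%:R).
Proof.
case=> cpos _ k0 L x; rewrite !ntildemE //.
have u0 := t2_gt0 _ c a b (cpos a) (cpos b).
have w0 := t2_gt0 _ c b a (cpos b) (cpos a).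
case: (C a b < 0) => /=; last by rewrite mul0r; ring.
case: (boolP (t2 c a b %| m)%N) => [/dvdnP[m' E]|ndv].
  rewrite E mulnK // in x *.
  set y := (m' * t2 c b a)%N%:Z - k%:Z.
  have xE : x = (t2 c a b)%:Z * y by rewrite /x /y !PoszM; ring.
  have := qnum_second_diff (c b) (t2 c b a) y w0.
  rewrite /= mul_t2 lcmnC -/L => D.
  have -> : (m' * t2 c b a)%N%:Z - k.-1%:Z = y + 1.
    by rewrite /y -{2}(prednK k0) intS; ring.
  have -> : (m' * t2 c b a)%N%:Z - k.+1%:Z = y - 1 by rewrite /y intS; ring.
  have -> : (x == 0) = (y == 0) by rewrite xE mulf_eq0 (gt_eqF (u0 : 0 < (t2 c a b)%:Z)).
  have -> : (absz x == t2 c a b * t2 c b a)%N = (absz y == t2 c b a)%N.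
    by rewrite xE abszM eqn_pmul2l.
  by rewrite -D; ring.
(* Here the left side is zero, and either indicator on the right would force t_ab to divide m t_ba,
   hence m. *)
have /negPf -> : x != 0.
  apply: contraNN ndv => /eqP x0; rewrite -(Gauss_dvdl _ (coprime_t2 _ c a b _ _)) //.
  by apply/dvdnP; exists k; lia.
have /negPf -> : (absz x != t2 c a b * t2 c b a)%N.
  apply: contraNN ndv => /eqP Ex; rewrite -(Gauss_dvdl _ (coprime_t2 _ c a b _ _)) //.
  have : ((t2 c a b)%:Z %| x)%Z by rewrite dvdzE Ex dvdn_mulr.
  by rewrite /x rpredBr; [rewrite dvdzE | rewrite dvdzE dvdn_mull].
by rewrite mulr0n !mulr0 !subr0 mulr0.
Qed.

(** * Symmetry of T_- (T_0 - T_+) *)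

Definition Tmx (n : nat) (c : 'I_n -> nat) (l : nat)
    (f : 'I_n -> nat -> 'I_n -> nat -> laurent) : 'M[laurent]_#|Hidx c l| :=
  \matrix_(i, j)
    let g : Hidx c l := enum_val i in let h : Hidx c l := enum_val j in
    f (tag g) (Hm g) (tag h) (Hm h).

Lemma sum_index_delta (n : nat) (c : 'I_n -> nat) (l : nat)
    (F : 'I_n -> nat -> laurent) (b : 'I_n) (k : nat) :
    (k <= t1 c b * l)%N -> F b 0%N = 0 -> F b (t1 c b * l)%N = 0 ->
  \sum_(j < #|Hidx c l|) F (tag (enum_val j)) (Hm (enum_val j)) *
    ((tag (enum_val j) == b)%:R * (Hm (enum_val j) == k)%:R) = F b k.
Proof.
move=> lek F0 Fl; rewrite -(sum_Hidx_delta n c l F b k lek F0 Fl).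
by rewrite -(@big_enum_val _ _ _ _ (Hidx c l)
  (fun h => F (tag h) (Hm h) * ((tag h == b)%:R * (Hm h == k)%:R))).
Qed.

Lemma Tmx_minus_mul_sym (n l : nat) (C : 'M[int]_n) (c : 'I_n -> nat) :
    left_symmetrizer c C ->
  let B := Tmx n c l (ntilde0 c) - Tmx n c l (@ntildep n) in
  let M := Tmx n c l (ntildem C c) *m B in
  M^T = M.
Proof.
move=> hc B M; have [cpos _] := hc.
pose V a m b k : laurent :=
  let L := (lcmn (c a) (c b))%:Z in
  let x := (m * t2 c b a)%N%:Z - (k * t2 c a b)%N%:Z in
  (C a b < 0)%R%:R * (absz (C a b) %/ t2 c a b)%N%:R *
  ((zpow L + zpow (- L)) * (x == 0)%:R
   - (absz x == t2 c a b * t2 c b a)%N%:R).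
have ME i j : M i j = V (tag (enum_val i)) (Hm (enum_val i))
                        (tag (enum_val j)) (Hm (enum_val j)).
  rewrite mxE; under eq_bigr => h _ do rewrite !mxE /ntilde0 /ntildep.
  set a := tag (enum_val i); set m := Hm (enum_val i).
  set b := tag (enum_val j); set k := Hm (enum_val j).
  have ml : (0 < m < t1 c a * l)%N by rewrite Hm_lt.
  have kl : (k < t1 c b * l)%N := Hm_lt _.
  have k0 : (0 < k)%N by [].
  rewrite /V -ntildem_second_diff //.
  have [G0 Gl] := ntildem_border n C c l a b m cpos ml.
  pose G b' k' := ntildem C c a m b' k'.
  (* G vanishes at the border, so k - 1 = 0 and k + 1 = t_b l need no separate treatment. *)
  have S s : (s <= t1 c b * l)%N -> _ :=
    fun le => sum_index_delta n c l G b s le G0 Gl.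
  have S2 := sum_index_delta n c l
    (fun b' k' => G b' k' * qnum (c b') 2) b k (ltnW kl).
  rewrite /= [G b 0%N]G0 [G b (_ * _)%N]Gl !mul0r in S2.
  rewrite [qnum _ _ * _]mulrC -(S2 erefl erefl).
  rewrite -[ntildem _ _ _ _ _ k.-1](S k.-1); last by lia.
  rewrite -[ntildem _ _ _ _ _ k.+1](S k.+1) //.
  rewrite -!sumrB; apply: eq_bigr => h _ /=; rewrite -/(G _ _).
  have -> : ((Hm (enum_val h)).+1 == k) = (Hm (enum_val h) == k.-1) by lia.
  by ring.
have signC a b : (C a b < 0) = (C b a < 0).
  have [_ /(_ a b) E] := hc.
  rewrite -(pmulr_rlt0 _ (_ : 0 < (c a)%:Z)) ?E ?pmulr_rlt0 //; exact: cpos.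
apply/matrixP => i j; rewrite mxE !ME /V.
set a := tag (enum_val i); set b := tag (enum_val j).
set m := Hm (enum_val i); set k := Hm (enum_val j).
(* Exchanging i and j keeps L, |c_ab| / t_ab and t_ab t_ba, and sends x to -x. *)
rewrite signC (coef_cartan_sym n C c b a hc) lcmnC.
rewrite -(opprB (m * _)%N%:Z) oppr_eq0 abszN.
by rewrite [(t2 c b a * _)%N]mulnC.
Qed.

(** * From the symmetric product to the symplectic relation *)

Lemma laurent_inv_ntilde0 (n : nat) (c : 'I_n -> nat) (a : 'I_n) (m : nat)
    (b : 'I_n) (k : nat) :
  laurent_inv (ntilde0 c a m b k) = ntilde0 c a m b k.
Proof.
by rewrite /ntilde0 -mulrA mulrC -natrM laurent_inv_natr_mul laurent_inv_qnum.
Qed.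

Lemma laurent_inv_ntildep (n : nat) (a : 'I_n) (m : nat) (b : 'I_n) (k : nat) :
  laurent_inv (ntildep a m b k) = ntildep a m b k.
Proof. by rewrite /ntildep -natrD -natrM laurent_inv_nat. Qed.

Lemma laurent_inv_ntildem (n : nat) (C : 'M[int]_n) (c : 'I_n -> nat)
    (a : 'I_n) (m : nat) (b : 'I_n) (k : nat) :
  laurent_inv (ntildem C c a m b k) = ntildem C c a m b k.
Proof.
rewrite /ntildem; case: ifP => _.
  by rewrite laurent_inv_natr_mul laurent_inv_qnum.
exact: (laurent_inv_nat 0).
Qed.

(** Transposition moves the row factor z^(c_a) to the columns and z |-> z^-1 inverts it; the rest is
    invariant. *)
Lemma dagger_Hmx_sub (n l : nat) (c : 'I_n -> nat)
    (f g : 'I_n -> nat -> 'I_n -> nat -> laurent) :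
    (forall a m b k, laurent_inv (f a m b k) = f a m b k) ->
    (forall a m b k, laurent_inv (g a m b k) = g a m b k) ->
  dagger (Hmx c l f - Hmx c l g) =
  (Tmx n c l f - Tmx n c l g)^T *m
    diag_mx (\row_i zpow (- (c (tag (enum_val i : Hidx c l)))%:Z)).
Proof.
move=> fE gE; apply/matrixP => i j; rewrite mul_mx_diag !mxE /=.
by rewrite -mulrBr laurent_inv_zpow_mul laurent_invB fE gE mulrC.
Qed.

Lemma Hmx_sub (n l : nat) (c : 'I_n -> nat)
    (f g : 'I_n -> nat -> 'I_n -> nat -> laurent) :
  Hmx c l f - Hmx c l g =
  diag_mx (\row_i zpow (c (tag (enum_val i : Hidx c l)))%:Z) *m
    (Tmx n c l f - Tmx n c l g).
Proof. by apply/matrixP => i j; rewrite mul_diag_mx !mxE /= mulrBr. Qed.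

(** B = T_0 - T_+ is symmetric and commutes with T_0. Symmetry of T_- B reads B T_-^T = T_- B,
    whence B (T_0 - T_-)^T = (T_0 - T_-) B. *)
Lemma symplectic_reduction (R : comNzRingType) (r : nat)
    (Z Z' T0 Tp Tm : 'M[R]_r) :
    T0^T = T0 -> Tp^T = Tp -> T0 *m Tp = Tp *m T0 ->
    (Tm *m (T0 - Tp))^T = Tm *m (T0 - Tp) ->
  Z *m (T0 - Tp) *m ((T0 - Tm)^T *m Z') =
  Z *m (T0 - Tm) *m ((T0 - Tp)^T *m Z').
Proof.
have trB (A B : 'M[R]_r) : (A - B)^T = A^T - B^T by rewrite raddfB.
move=> T0T TpT T0Tp; rewrite trmx_mul !trB T0T TpT => sym.
have comm : (T0 - Tp) *m (T0 - Tm^T) = (T0 - Tm) *m (T0 - Tp).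
  by rewrite mulmxBr [RHS]mulmxBl sym mulmxBl [T0 *m (_ - _)]mulmxBr T0Tp.
by rewrite !mulmxA -!(mulmxA Z) comm.
Qed.

Lemma Tmx_ntilde0 (n l : nat) (c : 'I_n -> nat) :
  Tmx n c l (ntilde0 c) =
  diag_mx (\row_i qnum (c (tag (enum_val i : Hidx c l))) 2).
Proof.
apply/matrixP => i j; rewrite !mxE /ntilde0 -(inj_eq enum_val_inj) Hidx_eqE.
by rewrite -mulrA -natrM mulnb mulr_natr.
Qed.

Lemma Tmx_ntildep_sym (n l : nat) (c : 'I_n -> nat) :
  (Tmx n c l (@ntildep n))^T = Tmx n c l (@ntildep n).
Proof.
apply/matrixP => i j; rewrite mxE [LHS]mxE [RHS]mxE /ntildep.
set g := enum_val i; set h := enum_val j.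
by rewrite (eq_sym (tag h)) addrC (eq_sym (Hm h).+1) (eq_sym (Hm h)).
Qed.

Lemma diag_mx_commute (R : comNzRingType) (r : nat) (d : 'rV[R]_r) (A : 'M[R]_r) :
    (forall i j, d 0 i * A i j = A i j * d 0 j) ->
  diag_mx d *m A = A *m diag_mx d.
Proof.
by move=> comm; rewrite mul_diag_mx mul_mx_diag; apply/matrixP => i j; rewrite 2!mxE.
Qed.

(** T_0 is the scalar [2]_(z_a) on the block of a, and T_+ has no entries between different
    blocks. *)
Lemma Tmx_ntilde0_ntildep_commute (n l : nat) (c : 'I_n -> nat) :
  Tmx n c l (ntilde0 c) *m Tmx n c l (@ntildep n) =
  Tmx n c l (@ntildep n) *m Tmx n c l (ntilde0 c).
Proof.
rewrite Tmx_ntilde0; apply: diag_mx_commute => i j.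
rewrite mxE [(\row__ _) _ _]mxE [Tmx _ _ _ _ _ _]mxE /ntildep mulrC.
by case: eqP => [-> //|_]; rewrite mulr0n !mul0r.
Qed.

Lemma symplectic_relation (n l : nat) (C : 'M[int]_n) (c : 'I_n -> nat) :
    left_symmetrizer c C ->
  let Ap := Hmx c l (ntilde0 c) - Hmx c l (@ntildep n) in
  let Am := Hmx c l (ntilde0 c) - Hmx c l (ntildem C c) in
  Ap *m dagger Am = Am *m dagger Ap.
Proof.
move=> hc Ap Am.
have Dm := dagger_Hmx_sub n l c _ _
  (laurent_inv_ntilde0 n c) (laurent_inv_ntildem n C c).
have Dp := dagger_Hmx_sub n l c _ _ (laurent_inv_ntilde0 n c) (laurent_inv_ntildep n).
have T0T : (Tmx n c l (ntilde0 c))^T = Tmx n c l (ntilde0 c).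
  by rewrite Tmx_ntilde0 tr_diag_mx.
have red := symplectic_reduction _ _
  (diag_mx (\row_i zpow (c (tag (enum_val i : Hidx c l)))%:Z))
  (diag_mx (\row_i zpow (- (c (tag (enum_val i : Hidx c l)))%:Z))) _ _ _
  T0T (Tmx_ntildep_sym n l c)
  (Tmx_ntilde0_ntildep_commute n l c) (Tmx_minus_mul_sym n l C c hc).
exact: etrans (congr2 mulmx (Hmx_sub n l c _ _) Dm)
  (etrans red (esym (congr2 mulmx (Hmx_sub n l c _ _) Dp))).
Qed.

(** * Coefficients of the entries: conditions (N1), (N2) and (N4) *)

Lemma coef_Hmx (n l : nat) (c : 'I_n -> nat)
    (f : 'I_n -> nat -> 'I_n -> nat -> laurent) (i j : 'I_#|Hidx c l|) (q : int) :
  let g : Hidx c l := enum_val i in let h : Hidx c l := enum_val j in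
  (Hmx c l f i j)@_q = (f (tag g) (Hm g) (tag h) (Hm h))@_(q - (c (tag g))%:Z).
Proof. by rewrite mxE coef_zpow_mul. Qed.

Lemma coef_natr (k : nat) (q : int) : (k%:R : laurent)@_q = (q == 0)%:R *+ k.
Proof. by rewrite -[k%:R]mulr1 coef_natr_mul coef_zpow eq_sym. Qed.

Lemma coef_ntilde0 (n : nat) (c : 'I_n -> nat) (a : 'I_n) (m : nat)
    (b : 'I_n) (k : nat) (q : int) :
  (ntilde0 c a m b k)@_q =
  ((a == b) && (m == k))%:R * ((q == - (c a)%:Z)%:R + (q == (c a)%:Z)%:R).
Proof.
rewrite /ntilde0 -mulrA mulrC -natrM mulnb coef_natr_mul qnum2 mcoeffD.
by rewrite !coef_zpow mulr_natl addrC ![_ == q]eq_sym.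
Qed.

Lemma coef_ntildep (n : nat) (a : 'I_n) (m : nat) (b : 'I_n) (k : nat) (q : int) :
  (ntildep a m b k)@_q =
  ((a == b) && (q == 0))%:R *+ ((m == k.+1) + (m.+1 == k)).
Proof.
rewrite /ntildep -natrD; case: (a == b); first by rewrite mul1r coef_natr.
by rewrite mul0r mcoeff0 mul0rn.
Qed.

Lemma coef_ntildem_ge0 (n : nat) (C : 'M[int]_n) (c : 'I_n -> nat)
    (a : 'I_n) (m : nat) (b : 'I_n) (k : nat) (q : int) :
  0 <= (ntildem C c a m b k)@_q.
Proof.
rewrite /ntildem; case: ifP => _; last by rewrite mcoeff0.
by rewrite coef_natr_mul mulrn_wge0 ?coef_qnum_ge0.
Qed.

(** Since z^(c_a) [2]_(z_a) = 1 + z^(2 c_a), the permutation is the identity and p_am = 2 c_a. *)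
Lemma condN1_ntilde0 (n l : nat) (c : 'I_n -> nat) : (forall a, (0 < c a)%N) ->
  condN1 (Hmx c l (ntilde0 c)) 1
    (fun i => (2 * c (tag (enum_val i : Hidx c l)))%N).
Proof.
move=> cpos; split=> [i|i j q]; first by rewrite muln_gt0 cpos.
rewrite coef_Hmx coef_ntilde0 -Hidx_eqE (inj_eq enum_val_inj) perm1 -mulrDr.
congr (_ * (_%:R + _%:R)).
  by rewrite subr_eq addNr.
by rewrite subr_eq -PoszD addnn mul2n.
Qed.

Lemma condN2_ntilde (n l : nat) (C : 'M[int]_n) (c : 'I_n -> nat) :
  condN2 (Hmx c l (@ntildep n)) (Hmx c l (ntildem C c)).
Proof.
move=> i j q; rewrite !coef_Hmx; split; last exact: coef_ntildem_ge0.
by rewrite coef_ntildep mulrn_wge0.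
Qed.

(** N_+ lives on the blocks a = b, where c_aa = 2 makes N_- vanish. *)
Lemma condN4_ntilde (n l : nat) (C : 'M[int]_n) (c : 'I_n -> nat) :
  gen_cartan C -> condN4 (Hmx c l (@ntildep n)) (Hmx c l (ntildem C c)).
Proof.
case=> C2 _ _ i j q; rewrite !coef_Hmx coef_ntildep /ntildem.
case: eqP => [->|_]; last by rewrite mul0rn mul0r.
by rewrite C2 mcoeff0 mulr0.
Qed.

(** * Condition (N3) and divisibility *)

(** Here |c_ab| = x t_ab and |c_ba| = x t_ba with the same x > 0, so divisibility passes to the
    coprime pair t_ab, t_ba. *)
Lemma cartan_dvdE (n : nat) (C : 'M[int]_n) (c : 'I_n -> nat) (a b : 'I_n) :
  left_symmetrizer c C -> C a b != 0 -> (C a b %| C b a)%Z = (t2 c a b == 1%N).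
Proof.
move=> hc nz; have [cpos _] := hc.
have [/dvdnP[x Ex] /dvdnP[y Ey]] := (t2_dvd_cartan a b hc, t2_dvd_cartan b a hc).
have := coef_cartan_sym n C c a b hc.
rewrite Ex Ey !mulnK ?t2_gt0 // => E; rewrite -{}E in Ey.
have x0 : (0 < x)%N.
  by move: nz; rewrite -absz_gt0 Ex muln_gt0 => /andP[].
rewrite dvdzE Ex Ey dvdn_pmul2l //.
apply/idP/eqP => [/gcdn_idPl <-|-> //].
by apply/eqP; apply: coprime_t2.
Qed.

Lemma condN3_ntilde (n l : nat) (C : 'M[int]_n) (c : 'I_n -> nat) :
    gen_cartan C -> left_symmetrizer c C -> (2 <= l)%N ->
  condN3 (Hmx c l (@ntildep n)) (Hmx c l (ntildem C c))
    (fun i => (2 * c (tag (enum_val i : Hidx c l)))%N) <-> dvd_cond C.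
Proof.
move=> [C2 Cle C0] hc l2; have [cpos _] := hc.
have lcmE a b : (c a * t2 c a b = c b * t2 c b a)%N by rewrite !mul_t2 lcmnC.
split=> [N3 a b|dv i j q].
  case: (eqVneq a b) => [->|/Cle]; first by left.
  rewrite le_eqVlt => /orP[/eqP Z|neg]; first by left; rewrite Z (C0 a b).1.
  have [nza nzb] : C a b != 0 /\ C b a != 0.
    have nz : C a b != 0 by rewrite lt_eqF.
    by split=> //; apply: contraNN nz => /eqP/(C0 a b).2 ->.
  rewrite (cartan_dvdE n C c a b) // (cartan_dvdE n C c b a) //.
  have [a0 b0] := (cpos a, cpos b).
  have u0 := t2_gt0 n c a b a0 b0; have w0 := t2_gt0 n c b a b0 a0.
  have [e [e0 Ea Eb]] := t1_split n c a b cpos.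
  (* The indices (a, t_ab) and (b, t_ba) have p = k, so the full [t_ba] occurs; l >= 2 places them
     in H. *)
  have [g [ga gm]] : exists h : Hidx c l, tag h = a /\ Hm h = t2 c a b.
    by apply: Hm_surj; rewrite u0 Ea; nia.
  have [h [hb hk]] : exists h : Hidx c l, tag h = b /\ Hm h = t2 c b a.
    by apply: Hm_surj; rewrite w0 Eb; nia.
  pose q := (c a)%:Z + ((c b)%:Z - (c b)%:Z * (t2 c b a)%:Z).
  have nz : (ntildem C c a (t2 c a b) b (t2 c b a))@_(q - (c a)%:Z) != 0.
    rewrite ntildemE // neg dvdnn divnn u0 mul1n subrr subn0.
    rewrite /q addrAC subrr add0r coef_natr_mul coef_qnum_low //.
    rewrite pnatr_eq0 -lt0n divn_gt0 // dvdn_leq ?absz_gt0 //.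
    exact: t2_dvd_cartan.
  have := N3 (enum_rank g) (enum_rank h) q.
  rewrite !coef_Hmx !enum_rankK ga gm hb hk.
  (* If q > 0, then L < c_a + c_b, so t_ab and t_ba are not both at least 2. If q is out of range,
     (N3) contradicts [nz]. *)
  have := lcmE a b; case: (boolP (0 < q < _)) => [/andP[q0 _]|_] E => [_|].
    by move: q0; rewrite /q; nia.
  by case=> // _ /eqP; rewrite (negPf nz).
rewrite !coef_Hmx; set a := tag _; set b := tag _ => out.
have [a0 b0] := (cpos a, cpos b).
(* The only exponent in N_+ is c_a, which is in range. *)
split; first by rewrite coef_ntildep; case: eqP out => [|_ _]; rewrite ?mul0rn //; lia.
rewrite /ntildem; case: ifP => [/and3P[neg _ _]|_]; last by rewrite mcoeff0.
rewrite coef_natr_mul coef_qnum_out ?mul0rn //.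
(* One of t_ab, t_ba is 1, so L is c_a or c_b; the bound then gives |q - c_a| < c_a for every
   exponent q. *)
have le : (c b * t2 c b a < c a + c b)%N.
  have nz : C a b != 0 by rewrite lt_eqF.
  case: (dv a b); rewrite (cartan_dvdE n C c) //.
  - by move=> /eqP u1; rewrite -lcmE u1; lia.
  - by move=> /eqP ->; lia.
  by apply: contraNN nz => /eqP/(C0 a b).2 ->.
by nia.
Qed.

(** * Assembling the T-datum *)

(** Conjugation by D = I changes nothing, and (N1) and (N3) already exclude negative powers of z. *)
Lemma Tdatum_identity (r : nat) (N0 Np Nm : 'M[laurent]_r) (sigma : 'S_r)
    (p : 'I_r -> nat) :
    condN1 N0 sigma p -> condN2 Np Nm -> condN3 Np Nm p -> condN4 Np Nm ->
    (N0 - Np) *m dagger (N0 - Nm) = (N0 - Nm) *m dagger (N0 - Np) ->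
  is_Tdatum (N0 - Np) (N0 - Nm) 1%:M.
Proof.
move=> N1 N2 N3 N4 sympl; rewrite /is_Tdatum map_mx1.
have neg i (q : int) : q < 0 -> ~~ (0 < q < (p i)%:Z).
  by move=> q0; rewrite negb_and ltNge ltW.
have Zzp : over_Zz Np by move=> i j q /(neg i) /(N3 i j q) [].
have Zzm : over_Zz Nm by move=> i j q /(neg i) /(N3 i j q) [].
have Zz0 : over_Zz N0.
  move=> i j q q0; rewrite N1.2.
  have -> : (q == 0) = false by lia.
  have -> : (q == (p i)%:Z) = false by lia.
  by rewrite !mulr0.
have id_comm (A : 'M[laurent]_r) : A *m 1%:M = 1%:M *m A.
  exact: etrans (mulmx1 A) (esym (mul1mx A)).
split.
- exact: scalar_mx_is_diag.
- by move=> i; rewrite mxE eqxx.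
- exists N0, Np, Nm; split.
  + by split.
  + by split.
  + by exists sigma; exists p; split; [exact: N1|exact: N2|exact: N3|exact: N4].
  + exact: id_comm.
  + split; first by exists Np; [exact: Zzp|exact: id_comm].
    by exists Nm; [exact: Zzm|exact: id_comm].
exact: etrans (congr1 (mulmx^~ _) (mulmx1 _))
  (etrans sympl (esym (congr1 (mulmx^~ _) (mulmx1 _)))).
Qed.

Theorem theorem4p12 (n l : nat) (C : 'M[int]_n) (c : 'I_n -> nat)
  (hC : gen_cartan C) (hc : left_symmetrizer c C) (hind : indecomposable C)
  (hl : (2 <= l)%N) :
  let r := #|Hidx c l| in
  let N0 : 'M[laurent]_r := Hmx c l (ntilde0 c) in
  let Np : 'M[laurent]_r := Hmx c l (@ntildep n) in
  let Nm : 'M[laurent]_r := Hmx c l (ntildem C c) in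
  let Ap := N0 - Np in
  let Am := N0 - Nm in
  (exists (sigma : 'S_r) (p : 'I_r -> nat),
    [/\ [/\ condN1 N0 sigma p, condN2 Np Nm & condN4 Np Nm],
        Ap *m dagger Am = Am *m dagger Ap
      & condN3 Np Nm p <-> dvd_cond C])
  /\ (dvd_cond C -> is_Tdatum Ap Am 1%:M).
Proof.
move=> r N0 Np Nm Ap Am; have [cpos _] := hc.
have N1 := condN1_ntilde0 n l c cpos.
have N2 := condN2_ntilde n l C c.
have N4 := condN4_ntilde n l C c hC.
have N3 := condN3_ntilde n l C c hC hc hl.
have sympl := symplectic_relation n l C c hc.
split=> [|dv].
  (* Unification with [N3] and [N1] supplies p_am = 2 c_a and the identity permutation. *)
  do 2 eexists; split; [|exact: sympl|exact: N3].
  by split; [exact: N1|exact: N2|exact: N4].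
exact: Tdatum_identity N1 N2 (N3.2 dv) N4 sympl.
Qed.
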